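(* Let $T=A+\mathrm iB$ and $S=U+\mathrm iV$, where $A,B,U,V$ are symmetric operators in $H$ (with $\operatorname{dom}(T)=\operatorname{dom}(A)\cap\operatorname{dom}(B)$, $\operatorname{dom}(S)=\operatorname{dom}(U)\cap\operatorname{dom}(V)$), and assume one of the following: (i) $A$ is selfadjoint and semibounded, and $U,V$ are $A$-compact; or (ii) $B$ is selfadjoint and semibounded, and $U,V$ are $B$-compact; or (iii) $A$ and $B$ are selfadjoint and semibounded, $U$ is $A$-compact and $V$ is $B$-compact. Then $W_e(T)=W_e(T+S)$.
   Context: $H$ is a separable infinite-dimensional complex Hilbert space. $W_e(T)=\{\lambda:\exists x_n\in\operatorname{dom}(T),\|x_n\|=1,x_n\stackrel{w}{\to}0,\langle Tx_n,x_n\rangle\to\lambda\}$. An operator $U$ is $A$-compact if $\operatorname{dom}(A)\subset\operatorname{dom}(U)$ and $U$ maps every sequence $(x_n)$ with $(x_n)$ and $(Ax_n)$ bounded to a sequence having a convergent subsequence. $T+S$ has domain $\operatorname{dom}(T)\cap\operatorname{dom}(S)$. *)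

(* Defs.v *)
From HB Require Import structures.
From mathcomp Require Import all_boot all_order all_algebra.
From mathcomp Require Import all_classical all_reals topology normedtype sequences.
From mathcomp Require Import complex.
Set Implicit Arguments. Unset Strict Implicit. Unset Printing Implicit Defensive.
Import Order.TTheory GRing.Theory Num.Theory numFieldTopology.Exports numFieldNormedType.Exports.
Local Open Scope classical_set_scope.
Local Open Scope ring_scope.

Section Hilbert.
Variables (R : realType) (H : lmodType R[i]) (ip : H -> H -> R[i]).

Definition inner_product : Prop :=
  [/\ forall (a : R[i]) x y z, ip (a *: x + y) z = a * ip x z + ip y z,
      forall x y, ip y x = conjc (ip x y),
      forall x, complex.Im (ip x x) = 0 /\ 0 <= complex.Re (ip x x)
    & forall x, ip x x = 0 -> x = 0].

Definition hnorm (x : H) : R := Num.sqrt (complex.Re (ip x x)).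

Definition cabs (z : R[i]) : R := Num.sqrt (complex.Re z ^+ 2 + complex.Im z ^+ 2).

Definition hcvg (u : nat -> H) (l : H) : Prop :=
  (fun n => hnorm (u n - l)) @ \oo --> (0 : R).

Definition hcomplete : Prop :=
  forall u : nat -> H,
    (forall e : R, 0 < e -> exists N, forall m n, (N <= m)%N -> (N <= n)%N ->
        hnorm (u m - u n) < e) ->
    exists l, hcvg u l.

Definition hseparable : Prop :=
  exists d : nat -> H, forall x (e : R), 0 < e -> exists n, hnorm (x - d n) < e.

(* infinite dimensionality: no finite family spans H; equivalently for every
   finite family there is a nonzero vector orthogonal to it *)
Definition hinfinite_dim : Prop :=
  forall s : seq H, exists x, x != 0 /\ forall y, y \in s -> ip x y = 0.

(* a (possibly unbounded, not necessarily densely defined) operator in H: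
   a domain and an action (only meaningful on the domain) *)
Record op := Op { dom : set H; app : H -> H }.

Definition linear_op (T : op) : Prop :=
  [/\ dom T 0,
      forall (a : R[i]) x y, dom T x -> dom T y -> dom T (a *: x + y)
    & forall (a : R[i]) x y, dom T x -> dom T y ->
        app T (a *: x + y) = a *: app T x + app T y].

Definition dense_set (D : set H) : Prop :=
  forall x (e : R), 0 < e -> exists y, D y /\ hnorm (x - y) < e.

Definition symmetric_op (T : op) : Prop :=
  [/\ linear_op T, dense_set (dom T)
    & forall x y, dom T x -> dom T y -> ip (app T x) y = ip x (app T y)].

Definition adj_dom (T : op) : set H :=
  [set y | exists z, forall x, dom T x -> ip (app T x) y = ip x z].

(* selfadjoint: symmetric and dom(T^* ) is contained in dom(T) (so T = T^* ) *)
Definition selfadjoint (T : op) : Prop :=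
  symmetric_op T /\ adj_dom T `<=` dom T.

Definition semibounded (T : op) : Prop :=
  exists c : R,
    (forall x, dom T x -> c * hnorm x ^+ 2 <= complex.Re (ip (app T x) x)) \/
    (forall x, dom T x -> complex.Re (ip (app T x) x) <= c * hnorm x ^+ 2).

Definition rel_compact (A U : op) : Prop :=
  dom A `<=` dom U /\
  forall x : nat -> H, (forall n, dom A (x n)) ->
    (exists M : R, forall n, hnorm (x n) <= M) ->
    (exists M : R, forall n, hnorm (app A (x n)) <= M) ->
    exists (phi : nat -> nat) (l : H),
      (forall n, (phi n < phi n.+1)%N) /\ hcvg (fun n => app U (x (phi n))) l.

Definition op_add (T S : op) : op :=
  Op (dom T `&` dom S) (fun x => app T x + app S x).

Definition op_AiB (A B : op) : op :=
  Op (dom A `&` dom B) (fun x => app A x + 'i%C *: app B x).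

Definition weak0 (x : nat -> H) : Prop :=
  forall y, (fun n => cabs (ip (x n) y)) @ \oo --> (0 : R).

Definition ess_num_range (T : op) : set R[i] :=
  [set lam | exists x : nat -> H,
     (forall n, dom T (x n)) /\ (forall n, hnorm (x n) = 1) /\ weak0 x /\
     (fun n => cabs (ip (app T (x n)) (x n) - lam)) @ \oo --> (0 : R)].

End Hilbert.

(* Main.v *)
Require Import Defs.
From HB Require Import structures.
From mathcomp Require Import all_boot all_order all_algebra.
From mathcomp Require Import all_classical all_reals topology normedtype sequences.
From mathcomp Require Import complex ring lra.
Set Implicit Arguments. Unset Strict Implicit. Unset Printing Implicit Defensive.
Import Order.TTheory GRing.Theory Num.Theory numFieldTopology.Exports numFieldNormedType.Exports.
Local Open Scope classical_set_scope.
Local Open Scope ring_scope.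

(** Everything reduces to the following: if A is selfadjoint and semibounded, U is symmetric and
    A-compact, and (x_n) is a weakly null sequence of unit vectors of dom(A), then
    |<U x_n, x_n>| <= eps (|<A x_n, x_n>| + c) eventually, for every eps > 0.  Then convergence of
    either <A x_n, x_n> or <(A + U) x_n, x_n> forces <U x_n, x_n> -> 0, and since all operators are
    symmetric, real and imaginary parts of the numerical range can be treated separately.

    After an affine change A >= 1.  Put Q = k (A + k)^-1, which tends strongly to 1 as k -> oo and
    commutes with A, and split U = Q U Q + D.  On weakly null unit sequences U Q x_n -> 0 in norm,
    because Q x_n is weakly null with A Q x_n bounded.  Compactness of U A^-1 makes
    ||D x|| <= eps ||A x|| for k large, and as D is symmetric, Krein's symmetrisation argument
    turns this operator bound into the form bound |<D x, x>| <= eps <A x, x>, without square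
    roots of A.

    Only the real inner product Re <x, y> is used, except to pass to the adjoint domain. *)

(** For c > 0, evaluate at the minimiser -b/c. If c = 0, nonnegativity of an affine function forces
    b = 0. If c < 0, the average of the values at t and -t, namely a + t^2 c, is negative for large
    t. *)
Lemma quadratic_ge0_discr (R : realFieldType) (a b c : R) :
  (forall t, 0 <= a + 2 * t * b + t ^+ 2 * c) -> b ^+ 2 <= a * c.
Proof.
move=> h; have a0 : 0 <= a by have := h 0; lra.
have [c0|c0|c0] := ltgtP c 0; last first.
- have [->|b0] := eqVneq b 0; first by rewrite c0 expr0n /= mulr0.
  (* At this point the affine function a + 2tb takes the value -1. *)
  have := h (- (a + 1) / (2 * b)); rewrite c0 mulr0 addr0.
  have -> : a + 2 * (- (a + 1) / (2 * b)) * b = -1 by field.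
  lra.
- have := h (- b / c).
  have -> : a + 2 * (- b / c) * b + (- b / c) ^+ 2 * c = a - b ^+ 2 / c.
    by field; rewrite gt_eqF.
  by rewrite subr_ge0 ler_pdivrMr.
- exfalso; pose t := (`|b| + a + 1) / - c + 1.
  have tp : 0 < - c by lra.
  have t1 : 1 <= t by rewrite /t lerDr divr_ge0 ?(ltW tp)// !addr_ge0.
  have tc : t * - c = `|b| + a + 1 - c by rewrite /t; field; lra.
  have hb := ler_norm b; have hb' := ler_norm (- b); rewrite normrN in hb'.
  have h1 := h t; have h2 := h (- t).
  have : 0 <= a + t ^+ 2 * c by nra.
  have -> : t ^+ 2 * c = - (t * (t * - c)) by ring.
  rewrite tc; have := normr_ge0 b; nra.
Qed.

(** * The real inner product Re <x, y> and orthogonal projection *)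

Section RealInnerProduct.
Variables (R : realType) (H : lmodType R[i]) (ip : H -> H -> R[i]).
Hypothesis Hip : inner_product ip.

Local Notation "r *:r x" := ((r%:C)%C *: x) (at level 40).

Definition re_ip (x y : H) : R := complex.Re (ip x y).
Local Notation rip := re_ip.
Local Notation hn := (hnorm ip).

Lemma ripC x y : rip x y = rip y x.
Proof. by case: Hip => _ hC _ _; rewrite /re_ip (hC y x); case: (ip y x). Qed.

Lemma ripDl x y z : rip (x + y) z = rip x z + rip y z.
Proof.
case: Hip => hl _ _ _; have := hl 1 x y z; rewrite scale1r mul1r /re_ip => ->.
by case: (ip x z) (ip y z) => ? ? [].
Qed.

Lemma rip0l z : rip 0 z = 0.
Proof. by have := ripDl 0 0 z; rewrite addr0; lra. Qed.

Lemma ip0l z : ip 0 z = 0.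
Proof.
case: Hip => hl _ _ _; have := hl 1 0 0 z; rewrite scale1r mul1r addr0.
by move=> h; apply: (addrI (ip 0 z)); rewrite -h addr0.
Qed.

Lemma ipZl a x z : ip (a *: x) z = a * ip x z.
Proof. by case: Hip => hl _ _ _; rewrite -[a *: x]addr0 hl ip0l addr0. Qed.

Lemma ripZl r x z : rip (r *:r x) z = r * rip x z.
Proof. by rewrite /re_ip ipZl; case: (ip x z) => ? ? /=; ring. Qed.

Lemma ripNl x z : rip (- x) z = - rip x z.
Proof. by apply/eqP; rewrite -addr_eq0 -ripDl addNr rip0l. Qed.

Lemma ripBl x y z : rip (x - y) z = rip x z - rip y z.
Proof. by rewrite ripDl ripNl. Qed.

Lemma ripDr x y z : rip x (y + z) = rip x y + rip x z.
Proof. by rewrite ripC ripDl !(ripC x). Qed.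

Lemma ripZr r x z : rip x (r *:r z) = r * rip x z.
Proof. by rewrite ripC ripZl ripC. Qed.

Lemma ripNr x z : rip x (- z) = - rip x z.
Proof. by rewrite ripC ripNl ripC. Qed.

Lemma ripBr x y z : rip x (y - z) = rip x y - rip x z.
Proof. by rewrite ripDr ripNr. Qed.

Lemma rip0r z : rip z 0 = 0. Proof. by rewrite ripC rip0l. Qed.

Definition ripE := (ripDl, ripDr, ripBl, ripBr, ripZl, ripZr, ripNl, ripNr).

Lemma rip_ge0 x : 0 <= rip x x.
Proof. by case: Hip => _ _ /(_ x)[]. Qed.

Lemma rip_eq0 x : rip x x = 0 -> x = 0.
Proof.
case: Hip => _ _ /(_ x)[h _] h0 hr; apply: h0; move: h hr; rewrite /re_ip.
by case: (ip x x) => a b /= -> ->.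
Qed.

(** Besides its use for orthogonality, this reduces vector identities to scalar ones: after pairing
    with an arbitrary w and expanding by [ripE], [ring] or [lra] can finish. *)
Lemma rip_orth_eq x y : (forall w, rip w x = rip w y) -> x = y.
Proof.
by move=> h; apply/eqP; rewrite -subr_eq0; apply/eqP/rip_eq0; rewrite ripBr h subrr.
Qed.

Lemma hnorm_sqr x : hn x ^+ 2 = rip x x.
Proof. by rewrite sqr_sqrtr// rip_ge0. Qed.

Lemma hnorm_ge0 x : 0 <= hn x. Proof. exact: sqrtr_ge0. Qed.

Lemma hnorm_eq0 x : hn x = 0 -> x = 0.
Proof. by move=> h; apply: rip_eq0; rewrite -hnorm_sqr h expr0n. Qed.

Lemma hnorm0 : hn 0 = 0.
Proof. by apply/eqP; rewrite -[_ == 0]sqrf_eq0 hnorm_sqr rip0l. Qed.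

Lemma hnorm_leP x (c : R) : 0 <= c -> rip x x <= c ^+ 2 -> hn x <= c.
Proof. by move=> c0; rewrite -hnorm_sqr ler_sqr// nnegrE ?hnorm_ge0. Qed.

Lemma cauchy_schwarz x y : `|rip x y| <= hn x * hn y.
Proof.
rewrite -ler_sqr ?nnegrE ?mulr_ge0 ?hnorm_ge0// real_normK ?num_real//.
rewrite exprMn !hnorm_sqr; apply: quadratic_ge0_discr => t.
have := rip_ge0 (x + t *:r y); rewrite !ripE (ripC y x).
by congr (_ <= _); ring.
Qed.

Lemma rip_le x y : rip x y <= hn x * hn y.
Proof. exact: le_trans (ler_norm _) (cauchy_schwarz _ _). Qed.

Lemma hnormD x y : hn (x + y) <= hn x + hn y.
Proof.
apply: hnorm_leP; first by rewrite addr_ge0 ?hnorm_ge0.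
rewrite !ripE (ripC y x) -!hnorm_sqr; have := rip_le x y; nra.
Qed.

Lemma hnormZ r x : hn (r *:r x) = `|r| * hn x.
Proof.
apply/eqP; rewrite -(@eqrXn2 _ 2%N) ?mulr_ge0 ?hnorm_ge0// exprMn !hnorm_sqr !ripE.
by rewrite real_normK ?num_real//; apply/eqP; ring.
Qed.

Lemma hnormN x : hn (- x) = hn x.
Proof. by rewrite /hnorm -/(rip _ _) -/(rip x x) !ripE opprK. Qed.

Lemma hnormBC x y : hn (x - y) = hn (y - x).
Proof. by rewrite -hnormN opprB. Qed.

Lemma hnormB x y : hn (x - y) <= hn x + hn y.
Proof. by rewrite -(hnormN y) hnormD. Qed.

Lemma hnorm_tri z x y : hn (x - y) <= hn (x - z) + hn (z - y).
Proof. by rewrite (le_trans _ (hnormD _ _))// addrA subrK. Qed.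

Lemma weak0_rip (x : nat -> H) y : weak0 ip x -> rip (x n) y @[n --> \oo] --> (0 : R).
Proof.
move=> /(_ y) h; apply/cvgr0Pnorm_lt => e e0.
move/cvgr0Pnorm_lt : h => /(_ e e0); apply: filterS => n; apply: le_lt_trans.
rewrite (ger0_norm (sqrtr_ge0 _)) /re_ip -sqrtr_sqr ler_sqrt ?lerDl ?sqr_ge0//.
by rewrite addr_ge0 ?sqr_ge0.
Qed.

Lemma hcvg_rip (u : nat -> H) l w :
  hcvg ip u l -> rip (u n) w @[n --> \oo] --> rip l w.
Proof.
move=> ul; apply/cvgrPdist_le => e e0.
have w1 : 0 < hn w + 1 by rewrite ltr_wpDl// hnorm_ge0.
move/cvgr0Pnorm_le : ul => /(_ (e / (hn w + 1)) (divr_gt0 e0 w1)).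
apply: filterS => n; rewrite (ger0_norm (hnorm_ge0 _)) ler_pdivlMr// => h.
rewrite -ripBl; apply: le_trans (cauchy_schwarz _ _) _.
rewrite hnormBC; apply: le_trans h; rewrite mulrDr mulr1 lerDl hnorm_ge0//.
Qed.

(** The projection argument: a minimising sequence for the distance from y to M is Cauchy by the
    parallelogram law, and y minus its limit is orthogonal to M. Real linearity of M suffices, as
    orthogonality is taken for Re <x, y>. *)
Lemma closed_subspace_full (M : set H) : hcomplete ip -> M 0 ->
  (forall r x y, M x -> M y -> M (r *:r x + y)) ->
  (forall u l, (forall n, M (u n)) -> hcvg ip u l -> M l) ->
  (forall y, (forall m, M m -> rip m y = 0) -> y = 0) ->
  forall y, M y.
Proof.
move=> Hc M0 ML Mcl Morth y.
pose S := [set rip (y - m) (y - m) | m in M].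
have S0 : S !=set0 by exists (rip (y - 0) (y - 0)); exists 0.
have lS : has_lbound S by exists 0 => _ [m _ <-]; exact: rip_ge0.
have hS : has_inf S by [].
pose d := inf S.
have dS m : M m -> d <= rip (y - m) (y - m) by move=> Mm; apply: ge_inf => //; exists m.
have /choice[m hm] : forall n : nat, exists m, M m /\ rip (y - m) (y - m) < d + @harmonic R n.
  move=> n; have [_ [m Mm <-] ?] :=
    @inf_adherent _ S (@harmonic R n) (harmonic_gt0 n) hS.
  by exists m.
clearbody d.
have ortho n w : M w -> rip (y - m n) w ^+ 2 <= @harmonic R n * rip w w.
  move=> Mw; apply: quadratic_ge0_discr => t.
  (* The competitor [m n] - tw of M is at squared distance at least d from y, while [m n] itself is
     within 1/(n+1) of d; this holds for all t, so the discriminant bound applies. *)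
  have [Mm lm] := hm n; have := dS _ (ML (- t) _ _ Mw Mm).
  rewrite (_ : y - (- t *:r w + m n) = (y - m n) + t *:r w); last first.
    by rewrite opprD rmorphN scaleNr opprK addrA addrAC.
  by move: (y - m n) lm => p lm; rewrite !ripE (ripC w p); lra.
have mdist a b : rip (m a - m b) (m a - m b) <= 2 * (@harmonic R a + @harmonic R b).
  have [Ma la] := hm a; have [Mb lb] := hm b.
  (* The midpoint of [m a] and [m b], written with combinations of the form rx + y; it too is at
     squared distance at least d from y. *)
  have := dS _ (ML (2^-1) _ _ Ma (ML (2^-1 - 1) _ _ Mb Mb)).
  have -> : y - (2^-1 *:r m a + ((2^-1 - 1) *:r m b + m b)) =
            2^-1 *:r ((y - m a) + (y - m b)).
    apply: rip_orth_eq => w; rewrite !ripE; lra.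
  have -> : m a - m b = (y - m b) - (y - m a) by rewrite opprB [RHS]addrC subrKA.
  move: la lb; move: (y - m a) (y - m b) => p q la lb; rewrite !ripE (ripC q p); lra.
have [l ml] : exists l, hcvg ip m l.
  apply: Hc => e e0.
  have : (harmonic n : R) @[n --> \oo] --> (0:R) by exact: cvg_harmonic.
  move/cvgr0Pnorm_lt => /(_ (e ^+ 2 / 4) ltac:(by rewrite divr_gt0// exprn_gt0)).
  move=> [N _ hN]; exists N => a b Na Nb.
  rewrite -ltr_sqr ?nnegrE ?hnorm_ge0 ?ltW// hnorm_sqr; apply: le_lt_trans (mdist _ _) _.
  have la : harmonic a < e ^+ 2 / 4 := le_lt_trans (ler_norm _) (hN a Na).
  have lb : harmonic b < e ^+ 2 / 4 := le_lt_trans (ler_norm _) (hN b Nb).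
  lra.
have -> : y = l; last by apply: (Mcl m l) => // n; case: (hm n).
apply/eqP; rewrite -subr_eq0; apply/eqP/Morth => w Mw; rewrite ripC ripBl.
have h1 : rip (y - m n) w @[n --> \oo] --> rip y w - rip l w.
  under eq_fun do rewrite ripBl; apply: cvgB; [exact: cvg_cst|exact: hcvg_rip].
have h2 : rip (y - m n) w ^+ 2 @[n --> \oo] --> (rip y w - rip l w) ^+ 2.
  exact: (cvgM h1 h1).
have h3 : (harmonic n : R) * rip w w @[n --> \oo] --> (0 : R).
  by rewrite -(mul0r (rip w w)); apply: cvgM; [exact: cvg_harmonic|exact: cvg_cst].
apply/eqP; rewrite -sqrf_eq0 eq_le sqr_ge0 andbT.
by apply: (ler_cvg_to h2 h3); apply: nearW => n; exact: ortho.
Qed.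

End RealInnerProduct.

(** * Selfadjoint operators and surjectivity in the coercive case *)

Section SelfadjointOperators.
Variables (R : realType) (H : lmodType R[i]) (ip : H -> H -> R[i]).
Hypothesis Hip : inner_product ip.

Local Notation "r *:r x" := ((r%:C)%C *: x) (at level 40).
Local Notation rip := (re_ip ip).
Local Notation hn := (hnorm ip).
Local Notation ripE := (ripE Hip).
Local Notation ripC := (ripC Hip).

(** If x were nonzero, some w in D would satisfy ||x - w|| < ||x||, whence ||x||^2 = Re <x - w, x> <
    ||x||^2. *)
Lemma dense_orth (D : set H) x : dense_set ip D ->
  (forall w, D w -> rip w x = 0) -> x = 0.
Proof.
move=> dD h; apply/(hnorm_eq0 Hip)/eqP/negPn/negP => x0.
have x1 : 0 < hn x by rewrite lt_def x0 hnorm_ge0.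
have [w [Dw hw]] := dD x _ x1.
have : rip x x = rip (x - w) x by rewrite ripBl// (h w)// subr0.
rewrite -hnorm_sqr// => e; have := rip_le Hip (x - w) x; rewrite -e; nra.
Qed.

Section LinearOp.
Variables (A : op H) (lA : linear_op A).

Lemma dom_comb r x y : dom A x -> dom A y -> dom A (r *:r x + y).
Proof. by case: lA => _ h _; exact: h. Qed.

Lemma app_comb r x y : dom A x -> dom A y ->
  app A (r *:r x + y) = r *:r app A x + app A y.
Proof. by case: lA => _ _ h; exact: h. Qed.

Lemma dom0 : dom A 0. Proof. by case: lA. Qed.

Lemma app0 : app A 0 = 0.
Proof.
case: lA => d0 _ /(_ 1 0 0 d0 d0); rewrite !scale1r !addr0 => h.
by apply: (addrI (app A 0)); rewrite -h addr0.
Qed.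

Lemma domZ r x : dom A x -> dom A (r *:r x).
Proof. by move=> dx; rewrite -[_ *: _]addr0; apply: dom_comb => //; exact: dom0. Qed.

Lemma appZ r x : dom A x -> app A (r *:r x) = r *:r app A x.
Proof. by move=> dx; rewrite -[_ *: x]addr0 app_comb ?app0 ?addr0//; exact: dom0. Qed.

Lemma domB x y : dom A x -> dom A y -> dom A (x - y).
Proof.
move=> dx dy; rewrite addrC -scaleN1r.
by case: lA => _ h _; exact: h.
Qed.

Lemma appB x y : dom A x -> dom A y -> app A (x - y) = app A x - app A y.
Proof.
move=> dx dy; rewrite addrC -scaleN1r.
by case: lA => _ _ ->//; rewrite scaleN1r addrC.
Qed.

End LinearOp.

Lemma symmetric_rip (A : op H) x y : symmetric_op ip A -> dom A x -> dom A y ->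
  rip (app A x) y = rip x (app A y).
Proof. by move=> [_ _ h] dx dy; rewrite /re_ip h. Qed.

Lemma symmetric_Im (A : op H) x : symmetric_op ip A -> dom A x ->
  complex.Im (ip (app A x) x) = 0.
Proof.
move=> [_ _ h] dx; case: Hip => _ hC _ _; have := h _ _ dx dx.
by rewrite (hC (app A x) x); case: (ip (app A x) x) => a b [] /=; lra.
Qed.

(** The adjoint domain is defined by the complex inner product. Testing the real identity on ix as
    well as on x recovers the imaginary parts, so y lies in the adjoint domain; density of dom A
    then identifies Ay. *)
Lemma selfadjoint_rip (A : op H) y z : selfadjoint ip A ->
  (forall x, dom A x -> rip (app A x) y = rip x z) -> dom A y /\ app A y = z.
Proof.
move=> [sA aA] h; have [lA dA _] := sA.
have dy : dom A y.
  apply: aA; exists z => x dx; apply/eqP; rewrite eq_complex; apply/andP; split.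
    by apply/eqP; exact: h.
  have : rip (app A ('i%C *: x)) y = rip ('i%C *: x) z.
    apply: h; case: lA => d0 h _; rewrite -[_ *: _]addr0; exact: h.
  have -> : app A ('i%C *: x) = 'i%C *: app A x.
    case: (lA) => d0 _ hl; rewrite -[_ *: x]addr0 hl// app0// addr0//.
  rewrite /re_ip !(ipZl Hip); case: (ip _ y) (ip x z) => ? ? [? ?] /=.
  by rewrite !mul0r !mul1r !add0r => /oppr_inj ->.
split=> //; apply/eqP; rewrite -subr_eq0; apply/eqP/(dense_orth dA) => w dw.
by rewrite ripBr// -symmetric_rip// h// subrr.
Qed.

(** The lower bound 1 is a normalisation that [op_affine] provides; it makes A^-1 a contraction. *)
Definition coercive (A : op H) := forall x, dom A x -> rip x x <= rip (app A x) x.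

Lemma coercive_norm (A : op H) x : coercive A -> dom A x -> hn x <= hn (app A x).
Proof.
move=> cA dx; have := cA x dx; rewrite -hnorm_sqr// => h.
have := rip_le Hip (app A x) x; have := hnorm_ge0 ip x; have := hnorm_ge0 ip (app A x).
have [->|] := eqVneq (hn x) 0; first by [].
move=> x0 a0 x1 h1; have x2 : 0 < hn x by rewrite lt_def x0.
by rewrite -(ler_pM2r x2) -expr2 (le_trans h).
Qed.

(** The range is closed because A is closed and bounded below, and a vector orthogonal to it lies in
    the kernel of A, which coercivity makes trivial. *)
Lemma selfadjoint_coercive_surj (A : op H) : hcomplete ip ->
  selfadjoint ip A -> coercive A -> forall y, exists2 x, dom A x & app A x = y.
Proof.
move=> Hc sA cA; have [symA _] := sA; have [lA _ _] := symA.
apply: (@closed_subspace_full _ _ _ Hip [set y | exists2 x, dom A x & app A x = y]) => //=.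
- by exists 0; [exact: dom0|exact: app0].
- move=> r _ _ [x dx <-] [y dy <-]; exists (r *:r x + y); first exact: dom_comb.
  exact: app_comb.
- move=> u l hu ul.
  have [x hx] : exists x : nat -> H, forall n, dom A (x n) /\ app A (x n) = u n.
    have /choice[x hx] : forall n, exists x, dom A x /\ app A x = u n.
      by move=> n; have [x] := hu n; exists x.
    by exists x.
  (* The preimages form a Cauchy sequence, since ||x|| <= ||Ax||. *)
  have [m xm] : exists m, hcvg ip x m.
    apply: Hc => e e0.
    move/cvgr0Pnorm_lt : ul => /(_ (e / 2) ltac:(by rewrite divr_gt0)) [N _ hN].
    exists N => a b Na Nb; have [da ea] := hx a; have [db eb] := hx b.
    have dab := domB lA da db.
    apply: le_lt_trans (coercive_norm cA dab) _; rewrite appB// ea eb.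
    apply: le_lt_trans (hnorm_tri Hip l _ _) _; rewrite (hnormBC Hip l).
    have h1 := le_lt_trans (ler_norm _) (hN a Na).
    have h2 := le_lt_trans (ler_norm _) (hN b Nb).
    by rewrite [e]splitr ltrD.
  (* A is closed: the identity Re <x_n, Aw> = Re <u_n, w> passes to the limit for every w in dom
     A. *)
  have [dm Am] : dom A m /\ app A m = l.
    apply: selfadjoint_rip => // w dw; rewrite ripC [RHS]ripC.
    have h1 := hcvg_rip (w := app A w) Hip xm; have h2 := hcvg_rip (w := w) Hip ul.
    have e : (fun n => rip (x n) (app A w)) = (fun n => rip (u n) w).
      by apply/funext => n; have [dn <-] := hx n; rewrite symmetric_rip.
    by rewrite e in h1; apply: cvg_unique h1 h2.
  by exists m.
- move=> y hy.
  have [dy Ay] : dom A y /\ app A y = 0.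
    apply: selfadjoint_rip => // x dx; rewrite rip0r//; apply: hy; by exists x.
  by apply: (rip_eq0 Hip); apply/eqP; rewrite eq_le rip_ge0// andbT
     (le_trans (cA y dy))// Ay rip0l.
Qed.

Definition op_affine (s c : R) (A : op H) : op H :=
  Op (dom A) (fun x => s *:r app A x + c *:r x).

Lemma op_affine_selfadjoint s c (A : op H) : s != 0 -> selfadjoint ip A ->
  selfadjoint ip (op_affine s c A).
Proof.
move=> s0 sA; have [symA _] := sA; have [lA dA _] := symA.
have ipZr (a : R[i]) x y : ip x (a *: y) = conjc a * ip x y.
  case: (Hip) => _ hC _ _; rewrite (hC (_ *: _)) ipZl// (hC x).
  by case: (ip x y) a => u v [p q]; rewrite /=; congr (_ +i* _)%C; ring.
have ipDr x y z : ip x (y + z) = ip x y + ip x z.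
  case: (Hip) => hl hC _ _; rewrite (hC (_ + _)) -[y in LHS]scale1r hl mul1r rmorphD.
  by rewrite /= -!hC.
have ipDl x y z : ip (x + y) z = ip x z + ip y z.
  by case: (Hip) => hl _ _ _; rewrite -[x in LHS]scale1r hl mul1r.
split; first split=> //.
- case: (lA) => d0 hd hl; split=> //= a x y dx dy; rewrite hl// !scalerDr !scalerA.
  by rewrite ![(_)%C * a]mulrC addrACA.
- move=> x y dx dy /=; rewrite ipDl ipDr !(ipZl Hip) !ipZr /= !oppr0.
  by case: symA => _ _ ->.
- move=> y [z hz] /=.
  (* Solving Re <sAx + cx, y> = Re <x, z> for Re <Ax, y>. *)
  suff [] : dom A y /\ app A y = s^-1 *:r (z - c *:r y) by [].
  apply: selfadjoint_rip => // x dx; have := hz x dx => /(congr1 (@complex.Re _)).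
  rewrite -/(re_ip ip _ _) -/(re_ip ip x z) /= !ripE => <-.
  by field.
Qed.

End SelfadjointOperators.

(** Log-convexity makes the ratios b_{m+1}/b_m nondecreasing. If the first one, r, exceeded q, then
    r^m b_0 <= b_m <= K q^m for all m, which is impossible since (q/r)^m tends to 0. *)
Lemma logconvex_ratio_le (R : realType) (b : nat -> R) (q K : R) : 0 < q ->
  (forall m, 0 <= b m) -> (forall m, b m.+1 ^+ 2 <= b m * b m.+2) ->
  (forall m, b m <= K * q ^+ m) -> b 1%N <= q * b 0%N.
Proof.
move=> q0 b0 bc bK; rewrite leNgt; apply/negP => h.
have b0p : 0 < b 0%N.
  rewrite lt_def b0 andbT; apply/eqP => b00; have := bc 0%N; rewrite b00 mul0r in h *.
  by nra.
pose r := b 1%N / b 0%N.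
have qr : q < r by rewrite ltr_pdivlMr.
have r0 : 0 < r by apply: lt_trans qr.
have step m : 0 < b m /\ r * b m <= b m.+1.
  elim: m => [|m [bm IH]]; first by split=> //; rewrite divfK// gt_eqF.
  have bm1 : 0 < b m.+1 by apply: lt_le_trans IH; rewrite mulr_gt0.
  split=> //; rewrite -(ler_pM2l bm); apply: le_trans (bc m).
  by rewrite mulrCA mulrA expr2 ler_pM2r.
have grow m : r ^+ m * b 0%N <= b m.
  elim: m => [|m IH]; first by rewrite mul1r.
  have [_] := step m; apply: le_trans; rewrite exprS -mulrA ler_pM2l//.
have : geometric K (q / r) n @[n --> \oo] --> (0 : R).
  apply: cvg_geometric; rewrite ger0_norm; last by apply: divr_ge0; exact: ltW.
  by rewrite (ltr_pdivrMr _ _ r0) mul1r.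
move/cvgr0Pnorm_lt => /(_ _ b0p) [N _ /(_ N (leqnn N))] /=.
move=> /(le_lt_trans (ler_norm _)).
rewrite expr_div_n mulrA ltr_pdivrMr ?exprn_gt0// => hN.
by have := le_trans (grow N) (bK N); rewrite mulrC leNgt hN.
Qed.

(** * Form bounds from operator bounds, and relatively compact operators *)

Section RelativeCompactness.
Variables (R : realType) (H : lmodType R[i]) (ip : H -> H -> R[i]).
Hypothesis Hip : inner_product ip.

Local Notation "r *:r x" := ((r%:C)%C *: x) (at level 40).
Local Notation rip := (re_ip ip).
Local Notation hn := (hnorm ip).
Local Notation ripE := (ripE Hip).
Local Notation ripC := (ripC Hip).
Local Notation coercive := (coercive ip).

(* Krein's argument: T = A^-1 D is symmetric for the form <A x, y>,
   and its powers grow at most like e^m *)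
Lemma symmetric_form_bound (A : op H) (D : H -> H) (e : R) : 0 < e ->
  symmetric_op ip A -> coercive A ->
  (forall y, exists2 x, dom A x & app A x = y) ->
  (forall x y, dom A x -> dom A y -> rip (D x) y = rip x (D y)) ->
  (forall x, dom A x -> hn (D x) <= e * hn (app A x)) ->
  forall x, dom A x -> `|rip (D x) x| <= e * rip (app A x) x.
Proof.
move=> e0 sA cA surjA sD De x dx; have [lA _ _] := sA.
have /choice[G hG] : forall y, exists x, dom A x /\ app A x = y.
  by move=> y; have [z dz Az] := surjA y; exists z.
have a_ge0 u : dom A u -> 0 <= rip (app A u) u.
  by move=> du; apply: le_trans (cA u du); exact: rip_ge0.
have aC u v : dom A u -> dom A v -> rip (app A u) v = rip (app A v) u.
  by move=> du dv; rewrite symmetric_rip// ripC.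
(* The Cauchy-Schwarz inequality for the form Re <Au, v>. *)
have aCS u v : dom A u -> dom A v ->
    rip (app A u) v ^+ 2 <= rip (app A u) u * rip (app A v) v.
  move=> du dv; apply: quadratic_ge0_discr => t.
  have := a_ge0 _ (dom_comb lA t dv du); rewrite app_comb// !ripE (aC v u)//; lra.
pose T u := G (D u); pose X m := iter m T x.
have dT u : dom A (T u) by case: (hG (D u)).
have AT u : app A (T u) = D u by case: (hG (D u)).
have dX m : dom A (X m) by case: m => [|m] //=; exact: dT.
pose b m := rip (app A (X m)) (X m).
have b1 : b 1%N <= e ^+ 2 * b 0%N.
  apply: (@logconvex_ratio_le _ b _ (hn (app A x) ^+ 2)).
  - by rewrite exprn_gt0.
  - by move=> m; exact: a_ge0.
  - move=> m; rewrite mulrC.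
    (* By symmetry one factor T moves across the form: <A T^(m+1) x, T^(m+1) x> and <A T^(m+2) x,
       T^m x> have the same real part. *)
    suff -> : b m.+1 = rip (app A (X m.+2)) (X m) by apply: aCS.
    rewrite /b [app A (X m.+2)]AT [app A (X m.+1)]AT.
    by rewrite (sD _ _ (dX m.+1) (dX m)) ripC.
  (* Since AT = D, the operator bound iterates to ||A T^m x|| <= e^m ||Ax||; and [b m] <= ||A T^m
     x||^2 by coercivity. *)
  - move=> m; have nX : hn (app A (X m)) <= e ^+ m * hn (app A x).
      elim: m => [|m IH]; first by rewrite mul1r.
      rewrite /= AT; apply: le_trans (De _ (dX m)) _.
      by rewrite exprS -mulrA ler_pM2l.
    rewrite -exprM mulnC exprM -exprMn mulrC.
    apply: le_trans (_ : hn (app A (X m)) ^+ 2 <= _); last first.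
      rewrite lerXn2r// nnegrE ?hnorm_ge0//.
      by apply: mulr_ge0; [apply: exprn_ge0; exact: ltW|exact: hnorm_ge0].
    apply: le_trans (rip_le Hip _ _) _; rewrite expr2 ler_wpM2l ?hnorm_ge0//.
    exact: (coercive_norm Hip).
(* With Dx = ATx this reads (Re <Dx, x>)^2 <= [b 1] [b 0], and [b 1] <= e^2 [b 0]. *)
have h := aCS _ _ (dX 1%N) dx; rewrite [app A (X 1%N)]AT /= in h.
have ea0 : 0 <= e * rip (app A x) x by apply: mulr_ge0; [exact: ltW|exact: a_ge0].
rewrite -ler_sqr ?nnegrE// real_normK ?num_real//.
apply: le_trans h _; rewrite exprMn (expr2 (rip (app A x) x)) mulrA ler_wpM2r ?a_ge0//.
by move: b1; rewrite /b /= AT.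
Qed.

(** Otherwise ||U y_n|| >= e along a subsequence, and a further one has U y_n -> l. By symmetry of
    U, Re <U y_n, w> = Re <y_n, Uw> -> 0 on the dense domain of U, so l = 0, a contradiction. *)
Lemma rel_compact_null (A U : op H) (y : nat -> H) (M N : R) :
  symmetric_op ip U -> rel_compact ip A U -> (forall n, dom A (y n)) ->
  (forall n, hn (y n) <= M) -> (forall n, hn (app A (y n)) <= N) ->
  (forall w, rip (y n) w @[n --> \oo] --> (0 : R)) ->
  hn (app U (y n)) @[n --> \oo] --> (0 : R).
Proof.
move=> sU [dAU cU] dy yM yN yw; apply: contrapT => /cvgr0Pnorm_lt.
move=> /existsNP[e] /not_implyP[e0 hne].
have /choice[psi hpsi] : forall n, exists m, (n <= m)%N /\ e <= hn (app U (y m)).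
  move=> n; apply: contrapT => /forallNP hn'; apply: hne; exists n => // m nm /=.
  rewrite (ger0_norm (hnorm_ge0 ip _)) ltNge; apply/negP => em; exact: (hn' m).
have [phi [l [phil Ul]]] := cU (y \o psi) (fun n => dy _)
  (ex_intro _ M (fun n => yM _)) (ex_intro _ N (fun n => yN _)).
have phin n : (n <= phi n)%N by elim: n => // n IH; apply: leq_ltn_trans IH (phil n).
(* [psi] need not be increasing, but [psi n] >= n and [phi n] >= n make the composite tend to
   infinity, which is all that is needed. *)
have sub : (psi \o phi) n @[n --> \oo] --> \oo.
  move=> P [n0 _ hP]; exists n0 => // n nn0; apply: hP => /=.
  by apply: leq_trans (nn0) _; apply: leq_trans (phin n) _; case: (hpsi (phi n)).
have [_ dU _] := sU.
have l0 : l = 0.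
  apply: (dense_orth Hip dU) => w dw; rewrite ripC.
  have h1 := hcvg_rip (w := w) Hip Ul.
  have h2 : rip (y ((psi \o phi) n)) (app U w) @[n --> \oo] --> (0 : R).
    by move: (cvg_comp _ _ sub (yw (app U w))).
  have E : (fun n => rip (app U ((y \o psi) (phi n))) w) =
           (fun n => rip (y ((psi \o phi) n)) (app U w)).
    by apply/funext => n; rewrite symmetric_rip//; apply: dAU; exact: dy.
  by rewrite E in h1; apply: cvg_unique h1 h2.
move/cvgr0Pnorm_lt : Ul => /(_ e e0) [n0 _ /(_ n0 (leqnn _))] /=.
rewrite l0 subr0 (ger0_norm (hnorm_ge0 ip _)) ltNge.
by case: (hpsi (phi n0)) => _ ->.
Qed.

(** * The resolvent (A + k)^-1, represented by [G] *)

Section Resolvent.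
Variables (A : op H) (k : R) (G : H -> H).
Hypotheses (sA : symmetric_op ip A) (cA : coercive A) (k0 : 0 < k).
Hypotheses (dG : forall y, dom A (G y)) (AG : forall y, app A (G y) = y - k *:r G y).

Let lA : linear_op A. Proof. by case: sA. Qed.

(** The difference w = x - Gy satisfies Aw = -kw, so coercivity gives ||w||^2 <= -k ||w||^2. *)
Lemma resolvent_unique x y : dom A x -> app A x + k *:r x = y -> x = G y.
Proof.
move=> dx Ax; have dw := domB lA dx (dG y).
apply/eqP; rewrite -subr_eq0; apply/eqP/(rip_eq0 Hip)/eqP.
rewrite eq_le rip_ge0// andbT; have := cA dw.
have -> : app A (x - G y) = - (k *:r (x - G y)).
  rewrite appB// AG -Ax scalerBr opprB; apply: (rip_orth_eq Hip) => w; rewrite !ripE; ring.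
rewrite (ripNl Hip) (ripZl Hip).
have := mulr_ge0 (ltW k0) (rip_ge0 Hip (x - G y)); lra.
Qed.

Lemma resolvent_sym x y : rip (G x) y = rip x (G y).
Proof.
have e z : z = app A (G z) + k *:r G z by rewrite AG subrK.
by rewrite [in LHS](e y) [in RHS](e x) !ripE symmetric_rip.
Qed.

(** Linearity of G follows from its symmetry, by moving G to the other argument and back. *)
Lemma resolventZ r x : G (r *:r x) = r *:r G x.
Proof. by apply: (rip_orth_eq Hip) => w; rewrite -resolvent_sym !ripE resolvent_sym. Qed.

Lemma resolventB x y : G (x - y) = G x - G y.
Proof. by apply: (rip_orth_eq Hip) => w; rewrite -resolvent_sym !ripE !resolvent_sym. Qed.

(** Expanding ||AGy + kGy||^2, the cross term 2k Re <AGy, Gy> is nonnegative. Both norm bounds below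
    come from this. *)
Let norm_split y : rip (app A (G y)) (app A (G y)) + k ^+ 2 * rip (G y) (G y) <= rip y y.
Proof.
have {5 6}-> : y = app A (G y) + k *:r G y by rewrite AG subrK.
rewrite !ripE (ripC (G y)); have h1 := cA (dG y); have h2 := rip_ge0 Hip (G y).
have := mulr_ge0 (ltW k0) (le_trans h2 h1); lra.
Qed.

Lemma resolvent_norm y : k * hn (G y) <= hn y.
Proof.
have kG0 : 0 <= k * hn (G y) by apply: mulr_ge0; [exact: ltW|exact: hnorm_ge0].
rewrite -ler_sqr ?nnegrE ?hnorm_ge0// exprMn !hnorm_sqr//.
by apply: le_trans (norm_split y); rewrite lerDr rip_ge0.
Qed.

Lemma app_resolvent_norm y : hn (app A (G y)) <= hn y.
Proof.
apply: hnorm_leP; rewrite ?hnorm_ge0// hnorm_sqr//.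
by apply: le_trans (norm_split y); rewrite lerDl mulr_ge0 ?rip_ge0// exprn_ge0// ltW.
Qed.

(** AGx = x - kGx lies in dom A, and applying A + k to it gives Ax; uniqueness concludes. *)
Lemma resolvent_comm x : dom A x -> dom A (app A (G x)) /\ app A (G x) = G (app A x).
Proof.
move=> dx; have d : dom A (app A (G x)).
  by rewrite AG; apply: domB => //; exact: domZ.
split=> //; apply: resolvent_unique => //.
rewrite {1}AG appB// ?appZ//; last exact: domZ.
by rewrite -addrA -scalerN -scalerDr addNr scaler0 addr0.
Qed.

End Resolvent.

Lemma resolvent_exists (A : op H) (k : R) : hcomplete ip -> selfadjoint ip A ->
  coercive A -> 0 < k ->
  exists G, (forall y, dom A (G y)) /\ (forall y, app A (G y) = y - k *:r G y).
Proof.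
move=> Hc sA cA k0.
have /(selfadjoint_coercive_surj Hip Hc) h :=
  op_affine_selfadjoint Hip k (oner_neq0 R) sA.
have /choice[G hG] : forall y, exists x, dom A x /\ app A x = y - k *:r x.
  move=> y; have [|x dx Ax] := h _ y.
    move=> x dx; rewrite /= !ripE; have := cA x dx.
    have := mulr_ge0 (ltW k0) (rip_ge0 Hip x); lra.
  by exists x; split=> //; rewrite -Ax /= addrK scale1r.
by exists G; split=> y; case: (hG y).
Qed.

End RelativeCompactness.

(** * Regularisation by the resolvent and smallness of the form of U *)

Section FormCompactness.
Variables (R : realType) (H : lmodType R[i]) (ip : H -> H -> R[i]).
Hypotheses (Hip : inner_product ip) (Hcomp : hcomplete ip).

Local Notation "r *:r x" := ((r%:C)%C *: x) (at level 40).
Local Notation rip := (re_ip ip).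
Local Notation hn := (hnorm ip).
Local Notation ripE := (ripE Hip).
Local Notation ripC := (ripC Hip).
Local Notation coercive := (coercive ip).

Section Yosida.
Variables (A U : op H) (G : R -> H -> H).
Hypotheses (sA : symmetric_op ip A) (cA : coercive A).
Hypotheses (sU : symmetric_op ip U) (cU : rel_compact ip A U).
Hypotheses (surjA : forall y, exists2 x, dom A x & app A x = y).
Hypotheses (dG : forall k : R, 0 < k -> forall y, dom A (G k y)).
Hypotheses (AG : forall k : R, 0 < k -> forall y, app A (G k y) = y - k *:r G k y).

Let Q (k : R) x := k *:r G k x.
Let lA : linear_op A. Proof. by case: sA. Qed.
Let lU : linear_op U. Proof. by case: sU. Qed.

Let dQ (k : R) x : 0 < k -> dom A (Q k x).
Proof. by move=> k0; apply: domZ => //; exact: dG. Qed.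

Let Q_norm (k : R) x : 0 < k -> hn (Q k x) <= hn x.
Proof.
move=> k0; rewrite hnormZ// gtr0_norm//.
exact: (resolvent_norm Hip cA k0 (dG k0) (AG k0)).
Qed.

Let Q_sym (k : R) x y : 0 < k -> rip (Q k x) y = rip x (Q k y).
Proof. by move=> k0; rewrite !ripE (resolvent_sym Hip sA (dG k0) (AG k0)). Qed.

Let QB (k : R) x y : 0 < k -> Q k (x - y) = Q k x - Q k y.
Proof. by move=> k0; rewrite /Q (resolventB Hip sA (dG k0) (AG k0)) scalerBr. Qed.

(** Here (1 - Q)x = AGx = GAx, and kG is a contraction. *)
Let subQ_norm (k : R) x : 0 < k -> dom A x -> k * hn (x - Q k x) <= hn (app A x).
Proof.
move=> k0 dx; rewrite -AG//.
have [_ ->] := resolvent_comm Hip sA cA k0 (dG k0) (AG k0) dx.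
exact: (resolvent_norm Hip cA k0 (dG k0) (AG k0)).
Qed.

Let subQ_contract (k : R) x : 0 < k -> hn (x - Q k x) <= hn x.
Proof.
by move=> k0; rewrite -AG//; exact: (app_resolvent_norm Hip cA k0 (dG k0) (AG k0)).
Qed.

Let app_subQ_norm (k : R) x : 0 < k -> dom A x -> hn (app A (x - Q k x)) <= hn (app A x).
Proof.
move=> k0 dx; rewrite -AG//.
have [_ ->] := resolvent_comm Hip sA cA k0 (dG k0) (AG k0) dx.
exact: (app_resolvent_norm Hip cA k0 (dG k0) (AG k0)).
Qed.

Let harmonic_lt (c e : R) : 0 < e -> \forall n \near \oo, c < n.+1%:R * e.
Proof.
move=> e0; have : (harmonic n : R) * c @[n --> \oo] --> (0 : R).
  by rewrite -(mul0r c); apply: cvgM; [exact: cvg_harmonic|exact: cvg_cst].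
move/cvgr0Pnorm_lt => /(_ e e0); apply: filterS => n /(le_lt_trans (ler_norm _)).
by rewrite /harmonic /= mulrC ltr_pdivrMr// mulrC.
Qed.

(** On dom A the distance ||z - Qz|| is at most ||Az||/k; density of dom A and ||1 - Q|| <= 1 extend
    the convergence to every vector. *)
Let subQ_cvg l (e : R) : 0 < e -> \forall n \near \oo, hn (l - Q n.+1%:R l) <= e.
Proof.
move=> e0; have [_ dA _] := sA.
have [z [dz lz]] := dA l (e / 2) ltac:(by rewrite divr_gt0).
apply: filterS (harmonic_lt (hn (app A z)) (_ : 0 < e / 2)); last by rewrite divr_gt0.
move=> n hz; have n0 : 0 < n.+1%:R :> R by [].
have -> : l - Q n.+1%:R l = (l - z - Q n.+1%:R (l - z)) + (z - Q n.+1%:R z).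
  by rewrite QB//; apply: (rip_orth_eq Hip) => w; rewrite !ripE; ring.
apply: le_trans (hnormD Hip _ _) _; rewrite [e]splitr lerD//.
  exact: le_trans (subQ_contract _ _) (ltW lz).
by rewrite -(ler_pM2l n0) (le_trans (subQ_norm _ _))// ltW.
Qed.

(* Compactness and contradiction: normalised counterexamples x_n at k = n+1 give (1 - Q)U x_n -> 0
   along a subsequence, and (1 - Q)x_n -> 0 in norm with A(1 - Q)x_n bounded *)
Lemma yosida_approx (e : R) : 0 < e -> exists2 k : R, 0 < k &
  forall x, dom A x -> hn (app U x - Q k (app U (Q k x))) <= e * hn (app A x).
Proof.
move=> e0; apply: contrapT => hno; have [dAU hU] := cU.
pose D k x := app U x - Q k (app U (Q k x)).
have /choice[x hx] : forall n, exists x, [/\ dom A x, hn (app A x) = 1 & e < hn (D n.+1%:R x)].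
  move=> n; have n0 : 0 < n.+1%:R :> R by [].
  have : ~ forall x, dom A x -> hn (D n.+1%:R x) <= e * hn (app A x).
    by move=> h; apply: hno; exists n.+1%:R.
  move=> /existsNP[x /not_implyP[dx /negP]]; rewrite -ltNge => hD.
  (* Homogeneity of D, used to rescale the counterexample to ||Ax|| = 1. *)
  have DZ r : D n.+1%:R (r *:r x) = r *:r D n.+1%:R x.
    rewrite /D /Q !(resolventZ Hip sA (dG n0) (AG n0)) appZ//; last exact: dAU.
    have -> : n.+1%:R *:r (r *:r G n.+1%:R x) = r *:r (n.+1%:R *:r G n.+1%:R x).
      by apply: (rip_orth_eq Hip) => w; rewrite !ripE; ring.
    rewrite appZ//; last by apply: dAU; exact: dQ.
    rewrite (resolventZ Hip sA (dG n0) (AG n0)).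
    by apply: (rip_orth_eq Hip) => w; rewrite !ripE; ring.
  have Ax0 : 0 < hn (app A x).
    rewrite lt_def hnorm_ge0 andbT; apply/eqP => Ax0.
    have x0 : x = 0.
      apply: (hnorm_eq0 Hip); apply/eqP; rewrite eq_le hnorm_ge0 andbT -Ax0.
      exact: (coercive_norm Hip).
    have D0 : D n.+1%:R x = 0.
      apply: (rip_orth_eq Hip) => w; have := congr1 (rip w) (DZ 0).
      by rewrite x0 scaler0 (ripZr Hip) mul0r (rip0r Hip).
    by move: hD; rewrite D0 hnorm0// Ax0 mulr0 ltxx.
  exists ((hn (app A x))^-1 *:r x); split; first exact: domZ.
    by rewrite appZ// hnormZ// ger0_norm ?invr_ge0 ?hnorm_ge0// mulVf// gt_eqF.
  by rewrite DZ hnormZ// ger0_norm ?invr_ge0 ?hnorm_ge0// mulrC ltr_pdivlMr.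
have dx n : dom A (x n) by case: (hx n).
have Ax1 n : hn (app A (x n)) = 1 by case: (hx n).
have x1 n : hn (x n) <= 1 by rewrite -(Ax1 n) (coercive_norm Hip).
pose v n := x n - Q n.+1%:R (x n).
have dv n : dom A (v n) by apply: domB => //; exact: dQ.
have Uv : hn (app U (v n)) @[n --> \oo] --> (0 : R).
  apply: (@rel_compact_null _ _ _ Hip A U v 1 1) => //.
  - by move=> n; apply: le_trans (subQ_contract _ _) (x1 n).
  - by move=> n; rewrite -(Ax1 n); exact: app_subQ_norm.
  - move=> w; apply/cvgr0Pnorm_le => d d0.
    apply: filterS (harmonic_lt (hn w) d0) => n hw.
    apply: le_trans (cauchy_schwarz Hip _ _) _.
    have := @subQ_norm n.+1%:R (x n) (ltr0Sn _ _) (dx n); rewrite Ax1 -/(v n) => hv.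
    rewrite -(ler_pM2l (ltr0Sn R n)) mulrA; have w0 := hnorm_ge0 ip w.
    by apply: le_trans (ler_wpM2r w0 hv) _; rewrite mul1r ltW.
have [||phi [l [phil Ul]]] := hU x dx; first by exists 1.
  by exists 1 => n; rewrite Ax1.
have phin n : (n <= phi n)%N by elim: n => // n IH; apply: leq_ltn_trans IH (phil n).
have e3 : 0 < e / 3 by rewrite divr_gt0.
have [N1 _ h1] := subQ_cvg l e3.
move/cvgr0Pnorm_lt : Uv => /(_ _ e3) [N2 _ h2].
move/cvgr0Pnorm_lt : Ul => /(_ _ e3) [N3 _ h3].
pose n := maxn N1 (maxn N2 N3); pose m := phi n.
have mN1 : (N1 <= m)%N by apply: leq_trans (phin n); rewrite leq_maxl.
have mN2 : (N2 <= m)%N.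
  by apply: leq_trans (phin n); rewrite (leq_trans (leq_maxl N2 N3))// leq_maxr.
have nN3 : (N3 <= n)%N by rewrite (leq_trans (leq_maxr N2 N3))// leq_maxr.
have {}h1 := h1 m mN1; have {}h2 := le_lt_trans (ler_norm _) (h2 m mN2).
have {}h3 := le_lt_trans (ler_norm _) (h3 n nN3); rewrite -/m in h3.
have [_ _] := hx m; apply/negP; rewrite -leNgt.
have m0 : 0 < m.+1%:R :> R by [].
set k := m.+1%:R in h1 m0 *; set y := app U (x m) in h3 *.
(* With y = U x_m and v = (1 - Q)x_m, D x_m = (1 - Q)y + QUv; splitting y as (y - l) + l leaves
   three terms of norm at most e/3. *)
have -> : D k (x m) = (y - l - Q k (y - l)) + ((l - Q k l) + Q k (app U (v m))).
  rewrite [app U (v m)]appB//; [|exact: dAU|by apply: dAU; exact: dQ].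
  rewrite !QB// -/y -/k; apply: (rip_orth_eq Hip) => w; rewrite /D -/y !ripE.
  ring.
apply: le_trans (hnormD Hip _ _) _.
have := hnormD Hip (l - Q k l) (Q k (app U (v m))).
have h4 := le_trans (@subQ_contract k (y - l) m0) (ltW h3).
have h5 := le_trans (@Q_norm k (app U (v m)) m0) (ltW h2).
lra.
Qed.

Lemma form_small_of_resolvent (x : nat -> H) (e : R) : 0 < e ->
  (forall n, dom A (x n)) -> (forall n, hn (x n) = 1) -> weak0 ip x ->
  \forall n \near \oo, `|rip (app U (x n)) (x n)| <= e * rip (app A (x n)) (x n).
Proof.
move=> e0 dx x1 xw; have [dAU _] := cU.
have e2 : 0 < e / 2 by rewrite divr_gt0.
have [k k0 hk] := yosida_approx e2.
pose D y := app U y - Q k (app U (Q k y)).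
have DA : forall y, dom A y -> `|rip (D y) y| <= e / 2 * rip (app A y) y.
  apply: (symmetric_form_bound Hip) => //.
  move=> y z dy dz; rewrite /D !(ripBl Hip) !(ripBr Hip); congr (_ - _).
    by rewrite (symmetric_rip sU)//; exact: dAU.
  by rewrite Q_sym// -[RHS]Q_sym// (symmetric_rip sU)//; apply: dAU; exact: dQ.
(* Here k is fixed: Q x_n is weakly null by symmetry of Q, and ||A Q x_n|| = k ||A G x_n|| <= k. *)
have UQ : hn (app U (Q k (x n))) @[n --> \oo] --> (0 : R).
  apply: (@rel_compact_null _ _ _ Hip A U (fun n => Q k (x n)) 1 k) => //.
  - by move=> n; exact: dQ.
  - by move=> n; rewrite -(x1 n); exact: Q_norm.
  - move=> n; rewrite appZ//; last exact: dG.
    rewrite hnormZ// gtr0_norm// -[leRHS]mulr1 -(x1 n) ler_pM2l//.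
    exact: (app_resolvent_norm Hip cA k0 (dG k0) (AG k0)).
  - move=> w; under eq_fun do rewrite Q_sym//.
    exact: weak0_rip.
move/cvgr0Pnorm_le : UQ => /(_ _ e2); apply: filterS => n.
rewrite (ger0_norm (hnorm_ge0 ip _)) => hn1.
have -> : rip (app U (x n)) (x n) =
    rip (D (x n)) (x n) + rip (app U (Q k (x n))) (Q k (x n)).
  by rewrite /D (ripBl Hip) Q_sym// subrK.
(* Coercivity gives <A x_n, x_n> >= 1, so the e/2 bounding the QUQ term is at most e/2 <A x_n,
   x_n>. *)
have h1 := DA _ (dx n); have h2 := cA (dx n).
rewrite -hnorm_sqr// x1 expr1n in h2.
have h3 := cauchy_schwarz Hip (app U (Q k (x n))) (Q k (x n)).
have h4 : hn (app U (Q k (x n))) * hn (Q k (x n)) <= e / 2.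
  rewrite -[leRHS]mulr1; apply: ler_pM; rewrite ?hnorm_ge0//.
  by rewrite -(x1 n); exact: Q_norm.
apply: le_trans (ler_normD _ _) _; nra.
Qed.

End Yosida.

Lemma form_small (A U : op H) (x : nat -> H) (e : R) : 0 < e ->
  selfadjoint ip A -> coercive A -> symmetric_op ip U -> rel_compact ip A U ->
  (forall n, dom A (x n)) -> (forall n, hn (x n) = 1) -> weak0 ip x ->
  \forall n \near \oo, `|rip (app U (x n)) (x n)| <= e * rip (app A (x n)) (x n).
Proof.
move=> e0 sA cA sU cU; have [symA _] := sA.
have /choice[G hG] : forall k : R, exists G : H -> H, 0 < k ->
    (forall y, dom A (G y)) /\ (forall y, app A (G y) = y - k *:r G y).
  (* Choice asks for a map at every real k; [id] is a dummy value for k <= 0. *)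
  move=> k; have [k0|k0] := ltP 0 k; last by exists id.
  by have [G hG] := resolvent_exists Hip Hcomp sA cA k0; exists G.
apply: (@form_small_of_resolvent A U G) => //.
- exact: (selfadjoint_coercive_surj Hip Hcomp).
- by move=> k k0; case: (hG k k0).
- by move=> k k0; case: (hG k k0).
Qed.

Lemma semibounded_coercive (A : op H) : semibounded ip A ->
  exists s c : R, `|s| = 1 /\ coercive (op_affine s c A).
Proof.
(* A lower bound c makes A + (1 - c) coercive; an upper bound c makes -A + (1 + c) coercive. *)
move=> [c [h|h]]; [exists 1, (1 - c)|exists (-1), (1 + c)]; split.
- by rewrite normr1.
- move=> x /= /h; rewrite !ripE -hnorm_sqr// /re_ip; lra.
- by rewrite normrN1.
- move=> x /= /h; rewrite !ripE -hnorm_sqr// /re_ip; lra.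
Qed.

Lemma op_affine_rel_compact (s c : R) (A U : op H) : `|s| = 1 ->
  rel_compact ip A U -> rel_compact ip (op_affine s c A) U.
Proof.
move=> s1 [dAU cU]; split=> // x dx [M hM] [N hN]; apply: cU => //; first by exists M.
exists (N + `|c| * M) => n.
have -> : hn (app A (x n)) = hn (s *:r app A (x n)) by rewrite hnormZ// s1 mul1r.
have -> : s *:r app A (x n) = app (op_affine s c A) (x n) - c *:r x n by rewrite /= addrK.
apply: le_trans (hnormB Hip _ _) _; rewrite lerD// hnormZ//.
by rewrite ler_wpM2l.
Qed.

(** The constant [c] is chosen before [e] and is multiplied by it, so boundedness of a already
    forces u to tend to 0. *)
Definition form_negligible (u a : nat -> R) :=
  exists c : R, forall e : R, 0 < e -> \forall n \near \oo, `|u n| <= e * (`|a n| + c).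

Lemma rel_compact_form_negligible (A U : op H) (x : nat -> H) :
  selfadjoint ip A -> semibounded ip A -> symmetric_op ip U -> rel_compact ip A U ->
  (forall n, dom A (x n)) -> (forall n, hn (x n) = 1) -> weak0 ip x ->
  form_negligible (fun n => rip (app U (x n)) (x n)) (fun n => rip (app A (x n)) (x n)).
Proof.
move=> sA /semibounded_coercive[s [c [s1 cA]]] sU cU dx x1 xw.
have s0 : s != 0 by rewrite -normr_eq0 s1 oner_eq0.
exists `|c| => e e0.
have := form_small e0 (op_affine_selfadjoint Hip c s0 sA) cA sU
  (op_affine_rel_compact c s1 cU) dx x1 xw.
apply: filterS => n /le_trans; apply; rewrite ler_pM2l// /= !ripE -hnorm_sqr//.
rewrite x1 expr1n mulr1; apply: le_trans (ler_norm _) _.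
by apply: le_trans (ler_normD _ _) _; rewrite normrM s1 mul1r.
Qed.

End FormCompactness.

(** * Limits of real sequences with a negligible perturbation *)

Lemma form_negligible_cvg (R : realType) (u a : nat -> R) (alpha : R) :
  form_negligible u a -> a n @[n --> \oo] --> alpha -> u n @[n --> \oo] --> (0 : R).
Proof.
move=> [c hc] /cvgrPdist_lt /(_ 1 ltr01) ha; apply/cvgr0Pnorm_le => e e0.
(* Eventually |a_n| <= |alpha| + 1, so C dominates |a_n| + c. *)
pose C := `|alpha| + 1 + `|c|.
have C0 : 0 < C by rewrite /C ltr_pwDl// ltr_wpDl.
apply: filterS2 ha (hc (e / C) (divr_gt0 e0 C0)) => n h1 /le_trans; apply.
rewrite -[leRHS](divfK (lt0r_neq0 C0)) ler_pM2l ?divr_gt0// /C lerD ?ler_norm//.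
have := ler_distD 0 (a n) alpha; have := ler_normB (a n) alpha.
have -> : a n = alpha - (alpha - a n) by rewrite opprB addrC subrK.
by move=> _ _; apply: le_trans (ler_normB _ _) _; rewrite lerD// ltW.
Qed.

Lemma cvg_add_null (R : realType) (f g : nat -> R) (l : R) :
  f n + g n @[n --> \oo] --> l -> g n @[n --> \oo] --> (0 : R) ->
  f n @[n --> \oo] --> l.
Proof.
move=> hfg hg; have h : f n + g n - g n @[n --> \oo] --> l - 0 by exact: cvgB hfg hg.
rewrite subr0 in h; suff -> : f = fun n => f n + g n - g n by [].
by apply/funext => n; rewrite addrK.
Qed.

(** Negligibility relative to a implies negligibility relative to a + u, since the |u| in |a| <= |a
    + u| + |u| can be absorbed; as a + u converges, u then tends to 0. *)
Lemma form_negligible_add_cvg (R : realType) (u a : nat -> R) (alpha : R) :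
  form_negligible u a -> a n + u n @[n --> \oo] --> alpha ->
  a n @[n --> \oo] --> alpha.
Proof.
move=> ua hau; suff nu : form_negligible u (fun n => a n + u n).
  exact: cvg_add_null hau (form_negligible_cvg nu hau).
have [c hc] := ua; exists c => e e0.
(* With d <= 1/2, the bound |u| <= d(|a + u| + |u| + c) yields |u| <= 2d(|a + u| + c), and 2d <=
   e. *)
pose d := Num.min e 1 / 2.
have d0 : 0 < d by rewrite divr_gt0// lt_min e0 ltr01.
have [de d1] : 2 * d <= e /\ 2 * d <= 1.
  have -> : 2 * d = Num.min e 1 by rewrite /d; field.
  by rewrite !ge_min !lexx orbT.
apply: filterS (hc d d0) => n h.
have h1 : `|a n| <= `|a n + u n| + `|u n|.
  by rewrite -{1}(addrK (u n) (a n)) ler_normB.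
have h2 : `|u n| <= 2 * d * (`|a n + u n| + c).
  have := normr_ge0 (u n); nra.
have h3 : 0 <= `|a n + u n| + c.
  have := normr_ge0 (u n); nra.
by apply: le_trans h2 _; rewrite ler_wpM2r.
Qed.

(** * Essential numerical range through real and imaginary parts *)

Section EssentialNumericalRange.
Variables (R : realType) (H : lmodType R[i]) (ip : H -> H -> R[i]).
Hypothesis Hip : inner_product ip.

Local Notation rip := (re_ip ip).
Local Notation form A x := (fun n => rip (app A (x n)) (x n)).

Lemma cabs_cvg (z : nat -> R[i]) lam :
  cabs (z n - lam) @[n --> \oo] --> (0 : R) <->
  (complex.Re (z n) @[n --> \oo] --> complex.Re lam /\
   complex.Im (z n) @[n --> \oo] --> complex.Im lam).
Proof.
have ReB (w l : R[i]) : complex.Re (w - l) = complex.Re w - complex.Re l.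
  by case: w l => ? ? [].
have ImB (w l : R[i]) : complex.Im (w - l) = complex.Im w - complex.Im l.
  by case: w l => ? ? [].
split.
- move/cvgr0Pnorm_le => h; split; apply/cvgrPdist_le => e e0;
    apply: filterS (h e e0) => n; rewrite ger0_norm ?sqrtr_ge0//; apply: le_trans;
    rewrite distrC -?ReB -?ImB -sqrtr_sqr ler_sqrt ?addr_ge0 ?sqr_ge0//.
    by rewrite lerDl sqr_ge0.
  by rewrite lerDr sqr_ge0.
- move=> [/cvgrPdist_le hr /cvgrPdist_le hi]; apply/cvgr0Pnorm_le => e e0.
  have e2 : 0 < e / 2 by rewrite divr_gt0.
  apply: filterS2 (hr _ e2) (hi _ e2) => n; rewrite distrC -ReB distrC -ImB.
  rewrite /cabs; move: (complex.Re _) (complex.Im _) => p q pe qe.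
  rewrite ger0_norm ?sqrtr_ge0// -(ger0_norm (ltW e0)) -sqrtr_sqr ler_sqrt ?sqr_ge0//.
  rewrite -(real_normK (num_real p)) -(real_normK (num_real q)).
  have := normr_ge0 p; have := normr_ge0 q; nra.
Qed.

Lemma ip_op_AiB (A B : op H) x : symmetric_op ip A -> symmetric_op ip B ->
  dom A x -> dom B x ->
  ip (app (op_AiB A B) x) x = (rip (app A x) x +i* rip (app B x) x)%C.
Proof.
move=> sA sB dA dB /=; rewrite /re_ip.
have := symmetric_Im Hip sA dA; have := symmetric_Im Hip sB dB.
have [hl _ _ _] := Hip; rewrite addrC hl.
case: (ip (app A x) x) (ip (app B x) x) => a1 a2 [b1 b2] /= -> ->.
by apply/eqP; rewrite eq_complex /=; apply/andP; split; apply/eqP; ring.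
Qed.

(** Forms of symmetric operators are real, so <Ax, x> and <Bx, x> are the real and imaginary parts
    of <Tx, x>, and convergence in C splits into two real limits. *)
Lemma ess_num_range_AiB (A B : op H) lam : symmetric_op ip A -> symmetric_op ip B ->
  ess_num_range ip (op_AiB A B) lam <->
  exists x : nat -> H, (forall n, dom A (x n) /\ dom B (x n)) /\
    (forall n, hnorm ip (x n) = 1) /\ weak0 ip x /\
    (form A x n @[n --> \oo] --> complex.Re lam) /\
    (form B x n @[n --> \oo] --> complex.Im lam).
Proof.
move=> sA sB.
suff E x : (forall n, dom A (x n) /\ dom B (x n)) ->
    cabs (ip (app (op_AiB A B) (x n)) (x n) - lam) @[n --> \oo] --> (0 : R) <->
    (form A x n @[n --> \oo] --> complex.Re lam) /\
    (form B x n @[n --> \oo] --> complex.Im lam).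
  by split=> -[x [dx [x1 [xw h]]]]; exists x; do 3![split=> //]; apply/E.
move=> dx.
have e : (fun n => ip (app (op_AiB A B) (x n)) (x n)) =
         (fun n => (form A x n +i* form B x n)%C).
  by apply/funext => n; have [? ?] := dx n; rewrite ip_op_AiB.
have -> : (fun n => cabs (ip (app (op_AiB A B) (x n)) (x n) - lam)) =
          (fun n => cabs ((form A x n +i* form B x n)%C - lam)).
  by apply/funext => n; rewrite -(congr1 (fun f => f n) e).
exact: (cabs_cvg (fun n => (form A x n +i* form B x n)%C)).
Qed.

Lemma ess_num_range_AiB_add (A B U V : op H) lam :
  symmetric_op ip A -> symmetric_op ip B -> symmetric_op ip U -> symmetric_op ip V ->
  ess_num_range ip (op_add (op_AiB A B) (op_AiB U V)) lam <->
  exists x : nat -> H, (forall n, (dom A (x n) /\ dom B (x n)) /\ (dom U (x n) /\ dom V (x n))) /\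
    (forall n, hnorm ip (x n) = 1) /\ weak0 ip x /\
    (form A x n + form U x n @[n --> \oo] --> complex.Re lam) /\
    (form B x n + form V x n @[n --> \oo] --> complex.Im lam).
Proof.
move=> sA sB sU sV.
suff E x : (forall n, (dom A (x n) /\ dom B (x n)) /\ (dom U (x n) /\ dom V (x n))) ->
    cabs (ip (app (op_add (op_AiB A B) (op_AiB U V)) (x n)) (x n) - lam)
      @[n --> \oo] --> (0 : R) <->
    (form A x n + form U x n @[n --> \oo] --> complex.Re lam) /\
    (form B x n + form V x n @[n --> \oo] --> complex.Im lam).
  by split=> -[x [dx [x1 [xw h]]]]; exists x; do 3![split=> //]; apply/E.
move=> dx.
have -> : (fun n => cabs (ip (app (op_add (op_AiB A B) (op_AiB U V)) (x n)) (x n) - lam)) =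
          (fun n => cabs (((form A x n + form U x n) +i* (form B x n + form V x n))%C - lam)).
  apply/funext => n; have [[? ?] [? ?]] := dx n; congr (cabs (_ - _)).
  have [hl _ _ _] := Hip.
  have -> : app (op_add (op_AiB A B) (op_AiB U V)) (x n) =
            1 *: app (op_AiB A B) (x n) + app (op_AiB U V) (x n) by rewrite scale1r.
  by rewrite hl mul1r !ip_op_AiB.
exact: (cabs_cvg (fun n => ((form A x n + form U x n) +i* (form B x n + form V x n))%C)).
Qed.

End EssentialNumericalRange.

(** * Invariance of the essential numerical range under the perturbation S *)

Theorem theorem4p5 (R : realType) (H : lmodType R[i]) (ip : H -> H -> R[i])
  (Hip : inner_product ip) (Hcomp : hcomplete ip) (Hsep : hseparable ip)
  (Hinf : hinfinite_dim ip)
  (A B U V : op H)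
  (HA : symmetric_op ip A) (HB0 : symmetric_op ip B)
  (HU : symmetric_op ip U) (HV : symmetric_op ip V) :
  ((selfadjoint ip A /\ semibounded ip A /\ rel_compact ip A U /\ rel_compact ip A V) \/
   (selfadjoint ip B /\ semibounded ip B /\ rel_compact ip B U /\ rel_compact ip B V) \/
   (selfadjoint ip A /\ semibounded ip A /\ selfadjoint ip B /\ semibounded ip B /\
    rel_compact ip A U /\ rel_compact ip B V)) ->
  ess_num_range ip (op_AiB A B) =
  ess_num_range ip (op_add (op_AiB A B) (op_AiB U V)).
Proof.
move=> hyp.
(* In all three cases dom T is contained in dom S, so T and T + S admit the same sequences.
   Whichever of the two forms converges along such a sequence, those of U and V tend to 0, so the
   same sequence serves both inclusions. *)
have [dUV key] : (forall x, dom A x -> dom B x -> dom U x /\ dom V x) /\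
    forall (x : nat -> H) (alpha beta : R),
      (forall n, dom A (x n) /\ dom B (x n)) -> (forall n, hnorm ip (x n) = 1) ->
      weak0 ip x ->
      let a n := re_ip ip (app A (x n)) (x n) in let b n := re_ip ip (app B (x n)) (x n) in
      let u n := re_ip ip (app U (x n)) (x n) in let v n := re_ip ip (app V (x n)) (x n) in
      (a n @[n --> \oo] --> alpha /\ b n @[n --> \oo] --> beta) \/
      (a n + u n @[n --> \oo] --> alpha /\ b n + v n @[n --> \oo] --> beta) ->
      u n @[n --> \oo] --> (0 : R) /\ v n @[n --> \oo] --> (0 : R).
  have small := rel_compact_form_negligible Hip Hcomp.
  case: hyp => [[sA [bA [cU cV]]]|[[sB [bB [cU cV]]]|[sA [bA [sB [bB [cU cV]]]]]]].
  - split; first by move=> x dA _; split; [exact: cU.1|exact: cV.1].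
    move=> x alpha beta dx x1 xw a b u v; have dA n := (dx n).1.
    have nu := small _ _ x sA bA HU cU dA x1 xw.
    have nv := small _ _ x sA bA HV cV dA x1 xw.
    (* U and V are both controlled by A, so convergence of the real part alone decides. *)
    have fin : a n @[n --> \oo] --> alpha ->
        u n @[n --> \oo] --> (0 : R) /\ v n @[n --> \oo] --> (0 : R).
      by move=> h; split; [exact: (form_negligible_cvg nu h)|
        exact: (form_negligible_cvg nv h)].
    by move=> [[h _]|[h _]]; apply: fin => //; exact: (form_negligible_add_cvg nu h).
  - split; first by move=> x _ dB; split; [exact: cU.1|exact: cV.1].
    move=> x alpha beta dx x1 xw a b u v; have dB n := (dx n).2.
    have nu := small _ _ x sB bB HU cU dB x1 xw.
    have nv := small _ _ x sB bB HV cV dB x1 xw.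
    have fin : b n @[n --> \oo] --> beta ->
        u n @[n --> \oo] --> (0 : R) /\ v n @[n --> \oo] --> (0 : R).
      by move=> h; split; [exact: (form_negligible_cvg nu h)|
        exact: (form_negligible_cvg nv h)].
    (* Now the imaginary part decides, and V is what perturbs it. *)
    by move=> [[_ h]|[_ h]]; apply: fin => //; exact: (form_negligible_add_cvg nv h).
  - split; first by move=> x dA dB; split; [exact: cU.1|exact: cV.1].
    move=> x alpha beta dx x1 xw a b u v.
    have nu := small _ _ x sA bA HU cU (fun n => (dx n).1) x1 xw.
    have nv := small _ _ x sB bB HV cV (fun n => (dx n).2) x1 xw.
    move=> [[ha hb]|[/(form_negligible_add_cvg nu) ha /(form_negligible_add_cvg nv) hb]].
      by split; [exact: (form_negligible_cvg nu ha)|exact: (form_negligible_cvg nv hb)].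
    by split; [exact: (form_negligible_cvg nu ha)|exact: (form_negligible_cvg nv hb)].
apply/seteqP; split=> lam /=.
- move=> /(ess_num_range_AiB Hip _ HA HB0)[x [dx [x1 [xw [ha hb]]]]].
  apply/(ess_num_range_AiB_add Hip _ HA HB0 HU HV); exists x.
  have [hu hv] := key x _ _ dx x1 xw (or_introl (conj ha hb)).
  split; first by move=> n; split=> //; apply: dUV; case: (dx n).
  do 2![split=> //].
  by split; rewrite -[_ lam]addr0; [exact: cvgD ha hu|exact: cvgD hb hv].
- move=> /(ess_num_range_AiB_add Hip _ HA HB0 HU HV)[x [dx [x1 [xw [ha hb]]]]].
  apply/(ess_num_range_AiB Hip _ HA HB0); exists x.
  have [hu hv] := key x _ _ (fun n => (dx n).1) x1 xw (or_intror (conj ha hb)).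
  split; first by move=> n; case: (dx n).
  do 2![split=> //].
  by split; [exact: cvg_add_null ha hu|exact: cvg_add_null hb hv].
Qed.
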